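(* There exist a positive integer $n$ and a coloring $\lambda$ of the vertices and edges of the complete graph $G=K_n$ (with no vertex having the same color as an edge) such that the ideal $I_{G}=I_{G,\lambda}$ is generated by binomials but the colored graph $(G,\lambda)$ is not RCOP.
   Context: A coloring $\lambda$ of a graph $G$ on $[n]$ assigns a color $\lambda(i)$ to each vertex and a color $\lambda(\{i,j\})$ to each edge. $\mathcal{L}_G$ is the linear space of real symmetric $n\times n$ matrices $K=(k_{ij})$ such that: $k_{ij}=0$ whenever $i\ne j$ and $\{i,j\}$ is not an edge; $k_{ii}=k_{jj}$ whenever $\lambda(i)=\lambda(j)$; $k_{ij}=k_{i'j'}$ whenever $\{i,j\},\{i',j'\}$ are edges with $\lambda(\{i,j\})=\lambda(\{i',j'\})$. Let $M_G=\{K^{-1}\mid K\in\mathcal{L}_G\text{ positive definite}\}$. $I_{G,\lambda}$ is the ideal of all polynomials in $\mathbb{R}[\sigma_{ij}\mid i,j\in[n]]/(\sigma_{ij}-\sigma_{ji})$ that vanish identically on $M_G$. A binomial is a polynomial of the form $\sigma^\alpha-\sigma^\beta$ for multi-indices $\alpha,\beta$. Let $\Gamma(G)$ be the group of graph automorphisms of $G$ that preserve all vertex colors and all edge colors. $(G,\lambda)$ is RCOP if: (1) the sets of vertex colors and edge colors are disjoint; (2) for any vertices $u,v$ of the same color there is $\gamma\in\Gamma(G)$ with $\gamma(v)=u$; (3) for any edges $e,f$ of the same color there is $\gamma\in\Gamma(G)$ with $\gamma(f)=e$. *)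

(* Defs.v *)
From HB Require Import structures.
From mathcomp Require Import all_boot all_order all_algebra all_fingroup.
From mathcomp Require Import reals.
From mathcomp Require Import mpoly.

Set Implicit Arguments.
Unset Strict Implicit.
Unset Printing Implicit Defensive.

Import Order.TTheory GRing.Theory Num.Theory.
Local Open Scope ring_scope.

Record sgraph (n : nat) := SGraph {
  adj :> rel 'I_n;
  adj_sym : ssrbool.symmetric adj;
  adj_irr : irreflexive adj
}.

Lemma neq_sym (n : nat) : ssrbool.symmetric (fun i j : 'I_n => i != j).
Proof. by move=> i j; rewrite eq_sym. Qed.

Lemma neq_irr (n : nat) : irreflexive (fun i j : 'I_n => i != j).
Proof. by move=> i; rewrite eqxx. Qed.

Definition complete_graph (n : nat) : sgraph n :=
  SGraph (@neq_sym n) (@neq_irr n).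

(* Edges are unordered pairs of vertices, represented as two-element sets. *)
Definition edges (n : nat) (G : sgraph n) : {set {set 'I_n}} :=
  [set [set p.1; p.2] | p : 'I_n * 'I_n & adj G p.1 p.2].

(* [ecol] is only ever consulted on the edges of the graph at hand; its values
   on other vertex sets are irrelevant. *)
Record coloring (C : Type) (n : nat) := Coloring {
  vcol : 'I_n -> C;
  ecol : {set 'I_n} -> C
}.

Section ColoredGraph.
Variables (C : Type) (n : nat) (G : sgraph n) (lam : coloring C n).

Definition disjoint_colors : Prop :=
  forall (i : 'I_n) (e : {set 'I_n}), e \in edges G -> vcol lam i <> ecol lam e.

Definition color_automorphism (g : {perm 'I_n}) : Prop :=
  [/\ forall i j, adj G (g i) (g j) = adj G i j,
      forall i, vcol lam (g i) = vcol lam i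
    & forall e, e \in edges G -> ecol lam (g @: e) = ecol lam e].

Definition RCOP : Prop :=
  [/\ disjoint_colors,
      forall u v : 'I_n, vcol lam u = vcol lam v ->
        exists2 g : {perm 'I_n}, color_automorphism g & g v = u
    & forall e f : {set 'I_n}, e \in edges G -> f \in edges G ->
        ecol lam e = ecol lam f ->
        exists2 g : {perm 'I_n}, color_automorphism g & g @: f = e].

End ColoredGraph.

Definition posdef (R : realType) (n : nat) (K : 'M[R]_n) : Prop :=
  K^T = K /\ forall x : 'cV[R]_n, x != 0 -> 0 < (x^T *m K *m x) 0 0.

(* R[sigma_ij | i, j in [n]] / (sigma_ij - sigma_ji) is the polynomial ring with
   one variable per unordered pair {i, j} (i = j allowed), here indexed by its
   representative with i <= j. *)
Definition upair (n : nat) : finType :=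
  {p : 'I_n * 'I_n | (p.1 <= p.2)%N}.

Definition sigma_ring (R : realType) (n : nat) := {mpoly R[#|upair n|]}.

Definition eval_at (R : realType) (n : nat) (S : 'M[R]_n)
    (p : sigma_ring R n) : R :=
  p.@[fun k => let ij := val (enum_val k : upair n) in S ij.1 ij.2].

Definition upair_rep (n : nat) (i j : 'I_n) : 'I_n * 'I_n :=
  if (i <= j)%N then (i, j) else (j, i).

Lemma upair_repP (n : nat) (i j : 'I_n) :
  ((upair_rep i j).1 <= (upair_rep i j).2)%N.
Proof. by rewrite /upair_rep; case: (leqP i j) => [|/ltnW]. Qed.

Definition mk_upair (n : nat) (i j : 'I_n) : upair n :=
  exist (fun p : 'I_n * 'I_n => (p.1 <= p.2)%N) (upair_rep i j) (upair_repP i j).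

Definition sigma (R : realType) (n : nat) (i j : 'I_n) : sigma_ring R n :=
  'X_(enum_rank (mk_upair i j)).

Lemma sigmaC (R : realType) (n : nat) (i j : 'I_n) : sigma R i j = sigma R j i.
Proof.
rewrite /sigma; suff -> : mk_upair i j = mk_upair j i by [].
by apply: val_inj; rewrite /= /upair_rep; case: (ltngtP i j) => // /val_inj ->.
Qed.

Lemma eval_at_sigma (R : realType) (n : nat) (S : 'M[R]_n) (i j : 'I_n) :
  S^T = S -> eval_at S (sigma R i j) = S i j.
Proof.
move=> symS; rewrite /eval_at /sigma mevalXU enum_rankK /= /upair_rep.
by case: (leqP i j) => //= _; rewrite -[in LHS]symS mxE.
Qed.

Definition in_LG (R : realType) (C : Type) (n : nat) (G : sgraph n)
    (lam : coloring C n) (K : 'M[R]_n) : Prop :=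
  [/\ K^T = K,
      forall i j, i != j -> ~~ adj G i j -> K i j = 0,
      forall i j, vcol lam i = vcol lam j -> K i i = K j j
    & forall i j i' j', adj G i j -> adj G i' j' ->
        ecol lam [set i; j] = ecol lam [set i'; j'] -> K i j = K i' j'].

Definition in_MG (R : realType) (C : Type) (n : nat) (G : sgraph n)
    (lam : coloring C n) (S : 'M[R]_n) : Prop :=
  exists K : 'M[R]_n, [/\ in_LG G lam K, posdef K & S = invmx K].

Definition in_IG (R : realType) (C : Type) (n : nat) (G : sgraph n)
    (lam : coloring C n) (p : sigma_ring R n) : Prop :=
  forall S : 'M[R]_n, in_MG G lam S -> eval_at S p = 0.

Section Binomial.
Variables (R : realType) (m : nat).

Definition is_binomial (p : {mpoly R[m]}) : Prop :=
  exists a b : 'X_{1..m}, p = 'X_[a] - 'X_[b].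

Definition ideal_gen (B : {mpoly R[m]} -> Prop) (p : {mpoly R[m]}) : Prop :=
  exists (k : nat) (c b : 'I_k -> {mpoly R[m]}),
    (forall i, B (b i)) /\ p = \sum_(i < k) c i * b i.

Definition generated_by_binomials (I : {mpoly R[m]} -> Prop) : Prop :=
  exists B : {mpoly R[m]} -> Prop,
    (forall b, B b -> is_binomial b) /\ (forall p, I p <-> ideal_gen B p).

End Binomial.

(* Main.v *)
(* If the vertex-edge colour classes of K_n form a symmetric association scheme,
   then L_G is its Bose-Mesner algebra; it is closed under inversion by
   Cayley-Hamilton, so M_G is the set of positive definite matrices of L_G, an
   open subset of L_G. Hence I_G is the ideal of the linear space L_G, generated
   by the differences of variables of equal colour. It remains to find a scheme
   whose classes are not orbits of its automorphism group: the Shrikhande graph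
   is strongly regular, but its automorphism group is not transitive on
   non-edges. *)
Require Import Defs.
From mathcomp Require Import all_boot all_order all_algebra all_fingroup.
From mathcomp Require Import reals.
From mathcomp Require Import mpoly.

Set Implicit Arguments.
Unset Strict Implicit.
Unset Printing Implicit Defensive.

Import Order.TTheory GRing.Theory Num.Theory.
Local Open Scope ring_scope.

(** * Polynomials vanishing on a box *)

Lemma meval_muni (R : comNzRingType) (n : nat) (p : {mpoly R[n.+1]})
    (v : 'I_n.+1 -> R) :
  (map_poly (meval (fun i => v (widen_ord (leqnSn n) i))) (muni p)).[v ord_max]
  = p.@[v].
Proof.
rewrite muniE mevalE raddf_sum /= horner_sum; apply: eq_bigr => m _.
rewrite map_polyZ /= map_polyXn hornerZ hornerXn mevalZ mevalX -mulrA.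
rewrite big_ord_recr /=; congr (_ * (_ * _)).
by apply: eq_bigr => i _; rewrite mnmE.
Qed.

(** With [meval_muni], this lets [p] be handled as a univariate polynomial in its last variable. *)
Lemma mcoeff_muni (R : nzRingType) (n : nat) (p : {mpoly R[n.+1]})
    (m : 'X_{1..n.+1}) :
  ((muni p)`_(m ord_max))@_[multinom m (widen_ord (leqnSn n) i) | i < n]
  = p@_m.
Proof.
rewrite muniE coef_sum raddf_sum [in RHS](mpolyE p) raddf_sum /=.
apply: eq_bigr => m' _; rewrite coefZ coefXn mcoeffZ mcoeffX mulr_natr mcoeffMn.
rewrite !mcoeffZ !mcoeffX -mulrnAr -mulrnA mulnb; congr (_ * (nat_of_bool _)%:R).
apply/andP/eqP => [[/eqP eqw /eqP eqx] | -> //].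
apply/mnmP => i; case: (unliftP ord_max i) => [j ->|-> //].
have -> : lift ord_max j = widen_ord (leqnSn n) j.
  by apply: val_inj; rewrite /= /bump leqNgt ltn_ord.
by move/mnmP: eqw => /(_ j); rewrite !mnmE.
Qed.

(** The points [a + (b - a) / (k + 1)] for [k < size p] are distinct roots, one too many for a
    nonzero [p]. *)
Lemma poly_eq0_itv (R : realFieldType) (p : {poly R}) (a b : R) :
  a < b -> (forall x, a <= x <= b -> p.[x] = 0) -> p = 0.
Proof.
move=> ltab p0; apply: contraTeq isT => pN0 /=.
pose s := [seq a + (b - a) / k.+1%:R | k <- iota 0 (size p)].
have := @max_poly_roots _ p s pN0; rewrite size_map size_iota ltnn.
have ba0 : 0 < b - a by rewrite subr_gt0.
case/(_ _ _)/implyP => //.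
  apply/allP => _ /mapP[k _ ->]; apply/rootP/p0.
  rewrite lerDl divr_ge0 ?ler0n ?(ltW ba0) //= -lerBrDl.
  by rewrite ler_pdivrMr ?ltr0Sn // ler_peMr ?(ltW ba0) // ler1n.
rewrite map_inj_uniq ?iota_uniq // => k l /addrI /(mulfI (lt0r_neq0 ba0)).
by move/invr_inj/eqP; rewrite eqr_nat => /eqP[].
Qed.

(** Induction on [n]: with the first coordinates fixed, [p] vanishes on an interval in the last one,
    so each coefficient of [muni p] vanishes on a box of lower dimension. *)
Lemma mpoly_eq0_box (R : realFieldType) (n : nat) (p : {mpoly R[n]})
    (a b : 'I_n -> R) :
    (forall i, a i < b i) ->
    (forall v, (forall i, a i <= v i <= b i) -> p.@[v] = 0) ->
  p = 0.
Proof.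
elim: n p a b => [|n IHn] p a b ltab p0.
  have := p0 (fun=> 0) (fun i : 'I_0 => ltac:(by case: i)).
  have -> : p = (p@_0)%:MP.
    apply/mpolyP => m; rewrite mcoeffC.
    have -> : m = 0%MM by apply/mnmP => -[].
    by rewrite eqxx mulr1.
  by rewrite mevalC => ->; rewrite mpolyC0.
apply/mpolyP => m; rewrite mcoeff0 -mcoeff_muni.
set k := m ord_max; set w := widen_ord (leqnSn n).
suff -> : (muni p)`_k = 0 by rewrite mcoeff0.
apply: (IHn _ (a \o w) (b \o w)) => [i|v vab]; first exact: ltab.
suff: map_poly (meval v) (muni p) = 0.
  by move/polyP/(_ k); rewrite coef_map coef0.
apply: (poly_eq0_itv (ltab ord_max)) => x xab.
pose u i := if unlift ord_max i is Some j then v j else x.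
have uw j : u (w j) = v j.
  have -> : w j = lift ord_max j.
    by apply: val_inj; rewrite /= /bump leqNgt ltn_ord.
  by rewrite /u liftK.
have ux : u ord_max = x by rewrite /u unlift_none.
rewrite -(p0 u).
  rewrite -meval_muni ux; congr (_.[x]).
  by apply/polyP => i; rewrite !coef_map /=; apply: meval_eq => j; rewrite uw.
move=> i; case: (unliftP ord_max i) => [j ->|->]; last by rewrite ux.
have <- : w j = lift ord_max j.
  by apply: val_inj; rewrite /= /bump leqNgt ltn_ord.
by rewrite uw; apply: vab.
Qed.

(** * Ideals given by generators *)

Section IdealGen.
Variables (R : realType) (m : nat) (B : {mpoly R[m]} -> Prop).

Lemma ideal_gen_gen b : B b -> ideal_gen B b.
Proof.
by move=> Bb; exists 1%N, (fun=> 1), (fun=> b); rewrite big_ord1 mul1r.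
Qed.

Lemma ideal_gen0 : ideal_gen B 0.
Proof. by exists 0%N, (fun=> 0), (fun=> 0); split=> [[]|]; rewrite ?big_ord0. Qed.

Lemma ideal_genD p q : ideal_gen B p -> ideal_gen B q -> ideal_gen B (p + q).
Proof.
move=> [k [c [b [Bb ->]]]] [l [d [e [Be ->]]]].
exists (k + l)%N, (fun i => match split i with inl j => c j | inr j => d j end),
  (fun i => match split i with inl j => b j | inr j => e j end).
split=> [i|]; first by case: split.
rewrite big_split_ord /=; congr (_ + _); apply: eq_bigr => i _.
  by rewrite -[lshift _ _]/(unsplit (inl i)) unsplitK.
by rewrite -[rshift _ _]/(unsplit (inr i)) unsplitK.
Qed.

Lemma ideal_genM a p : ideal_gen B p -> ideal_gen B (a * p).
Proof.
move=> [k [c [b [Bb ->]]]]; exists k, (fun i => a * c i), b; split=> //.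
by rewrite mulr_sumr; apply: eq_bigr => i _; rewrite mulrA.
Qed.

(** The [p] that agree with [p \mPo f] modulo the ideal contain constants and variables and are
    closed under sums and products. *)
Lemma ideal_gen_sub_comp (f : m.-tuple {mpoly R[m]}) :
    (forall i, ideal_gen B ('X_i - tnth f i)) ->
  forall p, ideal_gen B (p - (p \mPo f)).
Proof.
move=> Bf p; pose P q := ideal_gen B (q - (q \mPo f)); rewrite -/(P p).
have PD q r : P q -> P r -> P (q + r).
  by move=> Pq Pr; rewrite /P raddfD /= opprD addrACA; apply: ideal_genD.
have PM q r : P q -> P r -> P (q * r).
  move=> Pq Pr; rewrite /P rmorphM /=.
  have -> : q * r - (q \mPo f) * (r \mPo f)
    = r * (q - (q \mPo f)) + (q \mPo f) * (r - (r \mPo f)).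
    by rewrite !mulrBr [r * _]mulrC [r * _]mulrC addrA subrK.
  by apply: ideal_genD; apply: ideal_genM.
have PC c : P c%:MP by rewrite /P comp_mpolyC subrr; apply: ideal_gen0.
rewrite (mpolyE p); apply: big_ind => [||u _]; [exact: (PC 0) | exact: PD |].
rewrite -mul_mpolyC; apply: (PM) => //; rewrite mpolyXE_id.
apply: big_ind => [||i _]; [exact: (PC 1) | exact: PM |].
elim: (u i) => [|k IHk]; first by rewrite expr0; apply: (PC 1).
by rewrite exprS; apply: (PM) => //; rewrite /P comp_mpolyXU -tnth_nth.
Qed.

End IdealGen.

(** * Positive definite matrices *)

Section PositiveDefinite.
Variables (R : realType) (n : nat).
Implicit Types K : 'M[R]_n.

Lemma posdef_unitmx K : posdef K -> K \in unitmx.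
Proof.
move=> [_ Kpos]; rewrite -row_free_unit -kermx_eq0.
apply/eqP/row_matrixP => i; rewrite row0; apply/eqP; apply: contraTT isT => rN0.
have := Kpos (row i (kermx K))^T; rewrite trmx_eq0 => /(_ rN0).
by rewrite trmxK -row_mul mulmx_ker row0 mul0mx mxE ltxx.
Qed.

Lemma posdef_invmx K : posdef K -> posdef (invmx K).
Proof.
move=> Kpd; have Ku := posdef_unitmx Kpd; case: Kpd => Ksym Kpos.
have Vsym : (invmx K)^T = invmx K by rewrite trmx_inv Ksym.
split=> // x xN0; have -> : x^T *m invmx K *m x
    = (invmx K *m x)^T *m K *m (invmx K *m x).
  by rewrite trmx_mul Vsym !mulmxA mulmxKV.
apply: Kpos; apply: contraNneq xN0 => Vx0.
by rewrite -[x](mulKVmx Ku) Vx0 mulmx0.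
Qed.

(** Each diagonal entry exceeds the sum of the other absolute values in its row by at least 1,
    whence [x^T K x >= \sum_i x_i ^ 2]. *)
Lemma posdef_diag_dominant K :
    K^T = K -> (forall i, n%:R <= K i i) ->
    (forall i j, i != j -> `|K i j| <= 1) ->
  posdef K.
Proof.
move=> Ksym Kdiag Koff; split=> // x xN0.
have x2_gt0 : 0 < \sum_i x i 0 ^+ 2.
  have [i xi] : exists i, x i 0 != 0.
    apply/existsP; apply: contra_neqT xN0; rewrite negb_exists => /forallP x0.
    by apply/colP => i; rewrite mxE; apply/eqP; rewrite -[_ == _]negbK x0.
  rewrite (bigD1 i) //= ltr_pwDl ?exprn_even_gt0 // sumr_ge0 // => j _.
  exact: sqr_ge0.
apply: lt_le_trans x2_gt0 _.
have -> : (x^T *m K *m x) 0 0 = \sum_i \sum_j x i 0 * K i j * x j 0.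
  rewrite mxE exchange_big; apply: eq_bigr => j _; rewrite mxE mulr_suml.
  by apply: eq_bigr => i _; rewrite mxE.
(* Termwise lower bound: AM-GM off the diagonal; the same negative term is kept
   on the diagonal so that the bounds add up to [\sum_i x i ^ 2]. *)
pose F i j := (i == j)%:R * (n.+1%:R * x i 0 ^+ 2)
  - (x i 0 ^+ 2 + x j 0 ^+ 2) / 2.
have -> : \sum_i x i 0 ^+ 2 = \sum_i \sum_j F i j.
  under [RHS]eq_bigr => i _.
    rewrite big_split /= (bigD1 i) //= eqxx mul1r big1 => [|j]; last first.
      by rewrite eq_sym => /negbTE->; rewrite mul0r.
    rewrite sumrN -mulr_suml big_split /= sumr_const card_ord addr0; over.
  rewrite big_split /= sumrN -mulr_suml big_split /= sumr_const card_ord.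
  rewrite -mulr_sumr sumrMnl -mulr2n -[_ *+ n *+ 2]mulr_natr.
  rewrite mulfK ?pnatr_eq0 // -[_ *+ n]mulr_natl -mulrBl -natrB // subSnn.
  by rewrite mul1r.
apply: ler_sum => i _; apply: ler_sum => j _; rewrite /F.
have [<-|ij] := eqVneq i j.
  rewrite mul1r -mulr2n -[_ *+ 2]mulr_natr mulfK ?pnatr_eq0 //.
  rewrite -natr1 mulrDl mul1r addrK mulrAC -expr2 mulrC.
  by rewrite ler_wpM2l ?sqr_ge0 ?Kdiag.
rewrite mul0r add0r lerNl; apply: le_trans (ler_norm _) _.
rewrite normrN !normrM mulrAC.
apply: (@le_trans _ _ (`|x i 0| * `|x j 0|)).
  by rewrite ler_piMr ?mulr_ge0 ?normr_ge0 ?Koff.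
rewrite ler_pdivlMr ?ltr0n // mulr_natr -[x i 0 ^+ 2]real_normK ?num_real //.
rewrite -[x j 0 ^+ 2]real_normK ?num_real // -subr_ge0.
by rewrite addrAC -sqrrB sqr_ge0.
Qed.

End PositiveDefinite.

(** * Color-constant matrices and their inverses *)

Lemma invmx_horner (F : fieldType) (n : nat) (A : 'M[F]_n.+1) :
  A \in unitmx -> exists q, invmx A = horner_mx A q.
Proof.
move=> Au; pose p := char_poly A.
have p0N0 : p`_0 != 0.
  by rewrite char_poly_det mulf_neq0 ?signr_eq0 // -unitfE -unitmxE.
(* Since [p = p_0 + q X], Cayley-Hamilton gives [q(A) A = - p_0], and [p_0] is the determinant up to
   sign. *)
pose q := drop_poly 1 p; exists (- (p`_0)^-1 *: q).
have pE : p = (p`_0)%:P + q * 'X.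
  apply/polyP => -[|i]; rewrite coefD coefC coefMX /= ?addr0 // add0r.
  by rewrite coef_drop_poly addn1.
have : horner_mx A p = 0 by exact: Cayley_Hamilton.
rewrite {1}pE rmorphD rmorphM /= horner_mx_C horner_mx_X.
move/(congr1 (mulmx^~ (invmx A))); rewrite mul0mx mulmxDl mul_scalar_mx.
rewrite -[_ * A]/(_ *m A) mulmxK // => /eqP; rewrite addr_eq0 => /eqP eqV.
by rewrite linearZ /= scaleNr -scalerN -eqV scalerA mulVf // scale1r.
Qed.

Section PairColor.
Variables (C : eqType) (n : nat) (lam : coloring C n).

(** Vertex colors sit on the diagonal, so a coloring of [K_n] becomes a partition of all ordered
    pairs, as in an association scheme. *)
Definition pair_color (i j : 'I_n) : C :=
  if i == j then vcol lam i else ecol lam [set i; j].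

Definition color_constant (T : Type) (K : 'I_n -> 'I_n -> T) : Prop :=
  forall i j i' j', pair_color i j = pair_color i' j' -> K i j = K i' j'.

(* The axiom of a symmetric association scheme, with the intersection numbers
   recorded as multisets instead of being named. *)
Definition coherent : Prop :=
  forall i j i' j', pair_color i j = pair_color i' j' ->
    perm_eq [seq (pair_color i k, pair_color k j) | k <- enum 'I_n]
            [seq (pair_color i' k, pair_color k j') | k <- enum 'I_n].

Lemma pair_colorC i j : pair_color i j = pair_color j i.
Proof. by rewrite /pair_color eq_sym setUC; case: eqP => // ->. Qed.

Hypothesis lam_disj : disjoint_colors (complete_graph n) lam.

Lemma mem_edges_complete (i j : 'I_n) :
  i != j -> [set i; j] \in edges (complete_graph n).
Proof. by move=> ij; apply/imsetP; exists (i, j); rewrite ?inE. Qed.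

Lemma pair_color_diag i j i' j' :
  pair_color i j = pair_color i' j' -> (i == j) = (i' == j').
Proof.
rewrite /pair_color; have [_|ij] := eqVneq i j; have [_|ij'] := eqVneq i' j' => //.
  by move/(lam_disj (mem_edges_complete ij')).
by move/esym/(lam_disj (mem_edges_complete ij)).
Qed.

Lemma in_LG_complete (R : realType) (K : 'M[R]_n) :
  in_LG (complete_graph n) lam K <-> color_constant K.
Proof.
split=> [[Ksym _ Kdiag Koff] i j i' j' | Kc].
  move=> eqc; have := pair_color_diag eqc; move: eqc; rewrite /pair_color.
  have [<-|ij] := eqVneq i j; have [<-|ij'] := eqVneq i' j' => // + _.
    exact: Kdiag.
  exact: Koff.
split=> [|i j ij /negP[]//|i j eqc|i j i' j' ij ij' eqc].
- by apply/matrixP => i j; rewrite mxE; apply: Kc; apply: pair_colorC.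
- by apply: Kc; rewrite /pair_color !eqxx.
by apply: Kc; rewrite /pair_color (negbTE ij) (negbTE ij').
Qed.

Lemma color_constant_scalar_mx (R : pzSemiRingType) (a : R) :
  color_constant (a%:M : 'M_n).
Proof. by move=> i j i' j' /pair_color_diag eqd; rewrite !mxE eqd. Qed.

Hypothesis lam_coh : coherent.

(** An entry of the product sums, over [k], a function of the two colors met on the way through [k];
    coherence fixes the multiset of these color pairs. *)
Lemma color_constant_mulmx (R : pzSemiRingType) (K L : 'M[R]_n) :
  color_constant K -> color_constant L -> color_constant (K *m L).
Proof.
move=> Kc Lc i j i' j' eqc; rewrite !mxE.
(* Reads an entry off its color; the default 0 concerns only colors that no pair has. *)
pose entry (M : 'M[R]_n) c :=
  if [pick p | pair_color p.1 p.2 == c] is Some p then M p.1 p.2 else 0.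
have entryE (M : 'M[R]_n) k l : color_constant M ->
    M k l = entry M (pair_color k l).
  move=> Mc; rewrite /entry; case: pickP => [p /eqP eqp|/(_ (k, l))].
    exact: Mc.
  by rewrite eqxx.
pose G c := entry K c.1 * entry L c.2.
have sumE a b : \sum_k K a k * L k b =
    \sum_(c <- [seq (pair_color a k, pair_color k b) | k <- enum 'I_n]) G c.
  rewrite big_map big_enum; apply: eq_bigr => k _.
  by rewrite /G -!entryE.
by rewrite !sumE; apply/perm_big/lam_coh.
Qed.

End PairColor.

(** The inverse is a polynomial in [K], and color-constant matrices contain the scalars and are
    closed under sums and products. *)
Lemma color_constant_invmx (C : eqType) (n : nat) (lam : coloring C n)
    (F : fieldType) (K : 'M[F]_n) :
    disjoint_colors (complete_graph n) lam -> coherent lam ->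
    K \in unitmx -> color_constant lam K ->
  color_constant lam (invmx K).
Proof.
case: n lam K => [|n] lam K lam_disj lam_coh Ku Kc; first by move=> [].
have [q ->] := invmx_horner Ku.
elim/poly_ind: q => [|q c IHq]; first by rewrite rmorph0 => i j i' j'; rewrite !mxE.
rewrite rmorphD rmorphM /= horner_mx_C horner_mx_X => i j i' j' eqc.
rewrite mxE [RHS]mxE; congr (_ + _).
  exact: (color_constant_mulmx lam_coh IHq Kc).
exact: (color_constant_scalar_mx lam_disj c eqc).
Qed.

(** * The ideal of a coherent coloring *)

Section CoherentIdeal.
Variables (R : realType) (C : eqType) (n : nat) (lam : coloring C n).
Hypothesis lam_disj : disjoint_colors (complete_graph n) lam.
Hypothesis lam_coh : coherent lam.

Let m := #|upair n|.

Let ends (k : 'I_m) : 'I_n * 'I_n := val (enum_val k : upair n).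
Let var_color (k : 'I_m) : C := pair_color lam (ends k).1 (ends k).2.
Let var (i j : 'I_n) : 'I_m := enum_rank (mk_upair i j).

Let var_colorE i j : var_color (var i j) = pair_color lam i j.
Proof.
rewrite /var_color /ends /var enum_rankK /= /upair_rep.
by case: leqP => //= _; rewrite pair_colorC.
Qed.

(** One variable per color: the result of [choose] depends only on the predicate, not on the
    starting point [k]. *)
Let rep (k : 'I_m) : 'I_m := choose (fun l => var_color l == var_color k) k.

Let var_color_rep k : var_color (rep k) = var_color k.
Proof. by apply/eqP; apply: (@chooseP _ (fun l => var_color l == _)). Qed.

Let eq_rep k l : var_color k = var_color l -> rep k = rep l.
Proof.
by move=> eqc; rewrite /rep eqc; apply: choose_id; rewrite ?eqc.
Qed.

Let binomials (b : {mpoly R[m]}) : Prop :=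
  exists k l, var_color k = var_color l /\ b = 'X_k - 'X_l.

Let in_MG_invmx (S : 'M[R]_n) : in_MG (complete_graph n) lam S ->
  posdef S /\ color_constant lam S.
Proof.
move=> [K [/(in_LG_complete lam_disj) Kc Kpd ->]].
split; first exact: posdef_invmx.
by apply: color_constant_invmx => //; apply: posdef_unitmx.
Qed.

Let binomials_in_IG b : binomials b -> in_IG (complete_graph n) lam b.
Proof.
move=> [k [l [eqc ->]]] S /in_MG_invmx[_ Sc]; apply/eqP.
by rewrite /eval_at mevalB !mevalXU subr_eq0; apply/eqP/Sc.
Qed.

Let comp_rep : m.-tuple {mpoly R[m]} := [tuple 'X_(rep k) | k < m].

(* Any assignment of values to the colours with large diagonal and small
   off-diagonal values is realised by a point of [M_G]: such points form a box,
   so a polynomial vanishing on [M_G] vanishes after identifying the variables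
   of equal colour. *)
Let in_IG_comp_rep p : in_IG (complete_graph n) lam p -> p \mPo comp_rep = 0.
Proof.
move=> p0; pose diag k := (ends k).1 == (ends k).2.
(* The box has sides [[n, n + 1]] on the diagonal and [[0, 1]] elsewhere, as [posdef_diag_dominant]
   requires. *)
apply: (@mpoly_eq0_box _ _ _ (fun k => if diag k then n%:R else 0)
  (fun k => if diag k then n.+1%:R else 1)) => [k|v vbox].
  by case: ifP; rewrite ?ltr_nat ?ltr01.
rewrite comp_mpoly_meval.
pose S : 'M[R]_n := \matrix_(i, j) v (rep (var i j)).
have Sc : color_constant lam S.
  by move=> i j i' j' eqc; rewrite !mxE; congr v; apply: eq_rep; rewrite !var_colorE.
have diag_rep i j : diag (rep (var i j)) = (i == j).
  apply: (pair_color_diag lam_disj); rewrite -[RHS]var_colorE.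
  exact: var_color_rep.
have Spd : posdef S.
  apply: posdef_diag_dominant => [|i|i j ij].
  - by apply/matrixP => i j; rewrite mxE; apply: Sc; apply: pair_colorC.
  - by have := vbox (rep (var i i)); rewrite diag_rep eqxx mxE => /andP[].
  have := vbox (rep (var i j)); rewrite diag_rep (negbTE ij) mxE.
  by case/andP=> v0 v1; rewrite ger0_norm.
(* The required preimage is [invmx S], again color-constant and positive definite. *)
have SM : in_MG (complete_graph n) lam S.
  exists (invmx S); split; last by rewrite invmxK.
    apply/(in_LG_complete lam_disj); apply: color_constant_invmx => //.
    exact: posdef_unitmx.
  exact: posdef_invmx.
rewrite -[RHS](p0 S SM); apply: meval_eq => k.
rewrite tnth_mktuple mevalXU /= mxE; congr v; apply: eq_rep.
by rewrite var_colorE.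
Qed.

(** Modulo the binomials, [p] equals [p \mPo comp_rep], which is zero for [p] in the ideal. *)
Lemma coherent_generated_by_binomials :
  generated_by_binomials (@in_IG R C n (complete_graph n) lam).
Proof.
exists binomials; split=> [b [k [l [_ ->]]]|p]; first by exists U_(k)%MM, U_(l)%MM.
split=> [pI | [k [c [b [Bb ->]]]] S SM].
  rewrite -[p]subr0 -(in_IG_comp_rep pI); apply: ideal_gen_sub_comp => k.
  rewrite tnth_mktuple; apply: ideal_gen_gen; exists k, (rep k).
  by rewrite var_color_rep.
rewrite /eval_at raddf_sum big1 //= => i _; rewrite mevalM.
by have /(_ S SM) := binomials_in_IG (Bb i); rewrite /eval_at => ->; rewrite mulr0.
Qed.

End CoherentIdeal.

(** * The Shrikhande coloring of [K_16] *)

(* The Shrikhande graph: the Cayley graph of (Z/4)^2 with connection set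
   {(1,0), (0,1), (1,1)} and its opposites, with (x, y) encoded as 4 x + y. *)
Definition shrikhande (i j : nat) : bool :=
  ((i %/ 4 + 4 - j %/ 4) %% 4, (i %% 4 + 4 - j %% 4) %% 4)%N
    \in [:: (1, 0); (3, 0); (0, 1); (0, 3); (1, 1); (3, 3)]%N.

Definition shrikhande_coloring : coloring nat 16 :=
  Coloring (fun=> 0%N)
    (fun e => if [exists i in e, exists j in e, shrikhande i j] then 1%N else 2).

Definition shrikhande_color (i j : nat) : nat :=
  if i == j then 0%N else if shrikhande i j then 1%N else 2.

(** Turns a statement on ordinals into a closed boolean that [vm_compute] can decide. *)
Lemma forall_ord (n : nat) (P : pred nat) :
  all P (iota 0 n) -> forall i : 'I_n, P i.
Proof. by move/allP => allP i; apply: allP; rewrite mem_iota /=. Qed.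

Lemma forall_ord2 (n : nat) (P : rel nat) :
    all (fun i => all (P i) (iota 0 n)) (iota 0 n) ->
  forall i j : 'I_n, P i j.
Proof. by move=> allP i j; apply: forall_ord (forall_ord allP i) j. Qed.

Lemma shrikhande_sym (i j : 'I_16) : shrikhande i j = shrikhande j i.
Proof.
apply/eqP; move: i j.
by apply: (@forall_ord2 16 (fun i j => shrikhande i j == shrikhande j i)); vm_compute.
Qed.

Lemma shrikhande_irr (i : 'I_16) : shrikhande i i = false.
Proof.
by apply/negbTE; move: i; apply: (@forall_ord 16 (fun i => ~~ shrikhande i i)); vm_compute.
Qed.

Lemma ecol_shrikhande (i j : 'I_16) :
  ecol shrikhande_coloring [set i; j] = if shrikhande i j then 1%N else 2.
Proof.
rewrite /=; congr (if _ then _ else _); apply/existsP/idP => [[k] | ij].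
  case/andP=> + /existsP[l /andP[]]; rewrite !inE.
  by case/orP=> /eqP-> /orP[]/eqP->; rewrite ?shrikhande_irr // shrikhande_sym.
by exists i; rewrite !inE eqxx; apply/existsP; exists j; rewrite !inE eqxx orbT.
Qed.

Lemma pair_color_shrikhande (i j : 'I_16) :
  pair_color shrikhande_coloring i j = shrikhande_color i j.
Proof. by rewrite /pair_color ecol_shrikhande /shrikhande_color -val_eqE. Qed.

Lemma shrikhande_disjoint : disjoint_colors (complete_graph 16) shrikhande_coloring.
Proof. by move=> i e _ /=; case: ifP. Qed.

Lemma shrikhande_coherent : coherent shrikhande_coloring.
Proof.
pose tri i j := [seq (shrikhande_color i k, shrikhande_color k j) | k <- iota 0 16].
(* The pairs (0,0), (0,1), (0,2) represent the colours 0, 1, 2. *)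
have repP (i j : 'I_16) : perm_eq (tri i j) (tri 0%N (shrikhande_color i j)).
  move: i j; apply: (@forall_ord2 16
    (fun i j => perm_eq (tri i j) (tri 0%N (shrikhande_color i j)))).
  by vm_compute.
have triE (i j : 'I_16) : [seq (pair_color shrikhande_coloring i k,
    pair_color shrikhande_coloring k j) | k <- enum 'I_16] = tri i j.
  rewrite /tri -val_enum_ord -map_comp; apply: eq_map => k.
  by rewrite /= !pair_color_shrikhande.
move=> i j i' j'; rewrite !triE !pair_color_shrikhande => eqc.
by apply: perm_trans (repP i j) _; rewrite eqc perm_sym.
Qed.

(* The two common neighbours of the vertices (0,0) and (1,3) are adjacent, those
   of (0,0) and (2,0) are not; both pairs are non-edges. *)
Lemma shrikhande_not_RCOP : ~ RCOP (complete_graph 16) shrikhande_coloring.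
Proof.
pose vtx k : 'I_16 := inord k.
have vtxE k : (k < 16)%N -> vtx k = k :> nat by move=> k16; rewrite inordK.
have neq k l : (k < 16)%N -> (l < 16)%N -> k != l -> vtx k != vtx l.
  by move=> k16 l16; rewrite -val_eqE /= !vtxE.
case=> _ _ /(_ [set vtx 0%N; vtx 8%N] [set vtx 0%N; vtx 7%N]).
case=> [|||g [_ _ gE] eqg]; try exact/mem_edges_complete/neq.
  by rewrite !ecol_shrikhande !vtxE.
have g_adj (i j : 'I_16) : shrikhande i j -> shrikhande (g i) (g j).
  move=> ij; have iNj : i != j by apply: contraTneq ij => ->; rewrite shrikhande_irr.
  have := gE _ (mem_edges_complete iNj).
  rewrite imsetU1 imset_set1 !ecol_shrikhande ij.
  by case: (shrikhande (g i) (g j)).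
(* Only the set of endpoints is mapped to the other one, so common neighbours are tracked without
   knowing which endpoint goes where. *)
have g_nbr (k : 'I_16) : shrikhande k 0 -> shrikhande k 7 ->
    shrikhande (g k) 0 && shrikhande (g k) 8.
  move=> k0 k7; have nbr x : x \in [set vtx 0%N; vtx 8%N] -> shrikhande (g k) x.
    rewrite -eqg => /imsetP[y + ->]; rewrite !inE.
    by case/orP=> /eqP->; apply: g_adj; rewrite vtxE.
  by have := nbr _ (set21 _ _); have := nbr _ (set22 _ _); rewrite !vtxE // => -> ->.
pose nonadj_nbrs k l := ~~ [&& shrikhande k 0 && shrikhande k 8,
  shrikhande l 0 && shrikhande l 8 & shrikhande k l].
(* Vertices 3 and 4, that is (0,3) and (1,0), are the adjacent common neighbours of 0 and 7. *)
have: nonadj_nbrs (g (vtx 3%N)) (g (vtx 4%N)) by apply: forall_ord2; vm_compute.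
by rewrite /nonadj_nbrs !g_nbr ?g_adj ?vtxE.
Qed.

Theorem corollary1p2 (R : realType) :
  exists (n : nat) (lam : coloring nat n),
    [/\ (0 < n)%N,
        disjoint_colors (complete_graph n) lam,
        generated_by_binomials (@in_IG R nat n (complete_graph n) lam)
      & ~ RCOP (complete_graph n) lam].
Proof.
exists 16%N, shrikhande_coloring; split=> //.
- exact: shrikhande_disjoint.
- apply: coherent_generated_by_binomials.
    exact: shrikhande_disjoint.
  exact: shrikhande_coherent.
exact: shrikhande_not_RCOP.
Qed.
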